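(* For every integer $k\ge 1$, the quantity $\tau_k^{*}=\lim_{n\to\infty}\tau_{n,k}$ satisfies $$ \tau_{k}^{*}\leq \frac{(2k-1)!!}{(k+2)^{k}}. $$
   Context: $T_n$ is the $n$-th Chebyshev polynomial of the first kind, $T_n(\cos\theta)=\cos n\theta$, and $T_n^{(k)}$ is its $k$-th derivative. For integers $k\ge1$ and $n\geq k+2$, $\omega_{n,k}$ denotes the largest (rightmost) zero of the polynomial $T_n^{(k+1)}$ (all of whose zeros are real and lie in $(-1,1)$), and $$\tau_{n,k}:=\frac{|T_n^{(k)}(\omega_{n,k})|}{T_n^{(k)}(1)}.$$ It is known (from earlier work) that for each fixed $k$ the sequence $\{\tau_{n,k}\}_{n>k+1}$ is monotonically decreasing in $n$, so the limit $\tau_k^{*}:=\lim_{n\to\infty}\tau_{n,k}$ exists. Notation: $(2k-1)!!=1\cdot3\cdots(2k-1)$. *)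

(* Defs.v *)
From mathcomp Require Import all_boot all_order all_algebra.
From mathcomp Require Import all_classical all_reals all_analysis.
From mathcomp Require Import polyrcf.
From mathcomp Require Import ring lra.

Set Implicit Arguments.
Unset Strict Implicit.
Unset Printing Implicit Defensive.

Import Order.TTheory GRing.Theory Num.Theory.
Import numFieldNormedType.Exports.

Local Open Scope ring_scope.

(* Chebyshev polynomials of the first kind, by the three-term recurrence; the
   trigonometric definition is chebT_cos. *)
Fixpoint chebT (R : nzRingType) (n : nat) : {poly R} :=
  match n with
  | 0%N => 1
  | 1%N => 'X
  | (m.+1 as l).+1 => 2 *: ('X * chebT R l) - chebT R m
  end.

Lemma chebT_cos (R : realType) (n : nat) (t : R) :
  (chebT R n).[cos t] = cos (n%:R * t).
Proof.
suff [] : (chebT R n).[cos t] = cos (n%:R * t) /\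
          (chebT R n.+1).[cos t] = cos (n.+1%:R * t) by [].
elim: n => [|n [IH0 IH1]]; first by rewrite /= hornerC hornerX mul0r cos0 mul1r.
split=> //; rewrite [chebT R n.+2]/= hornerD hornerN hornerZ hornerM hornerX.
rewrite IH0 -[X in X.[_]]/(chebT R n.+1) IH1.
have -> : n%:R * t = n.+1%:R * t - t by rewrite -natr1; ring.
have -> : n.+2%:R * t = n.+1%:R * t + t by rewrite -[n.+2%:R]natr1; ring.
rewrite cosB cosD; ring.
Qed.

Definition largest_root (R : realType) (p : {poly R}) : set R :=
  [set x | root p x /\ forall y, root p y -> y <= x]%classic.

Lemma rolle_roots (R : realType) (p : {poly R}) (x : R) (s : seq R) :
  path <%R x s -> root p x -> all (root p) s ->
  exists s', [/\ path <%R x s', size s' = size s & all (root p^`()) s'].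
Proof.
elim: s x => [|y s IH] x /=; first by move=> _ _ _; exists [::].
move=> /andP[xy ys] px /andP[py ps].
have [s' [ys' ss' ps']] := IH y ys py ps.
have [|c cxy c0] := @poly_rolle R x y p xy.
  by rewrite (rootP px) (rootP py).
move: cxy; rewrite in_itv/= => /andP[xc cy].
exists (c :: s'); split=> /=; last by rewrite ps' rootE c0 eqxx.
  rewrite xc /=; case: s' ys' {ss' ps'} => //= z s' /andP[yz ->].
  by rewrite (lt_trans cy yz).
by rewrite ss'.
Qed.

Lemma rolle_rootsn (R : realType) (p : {poly R}) (s : seq R) (m : nat) :
  sorted <%R s -> all (root p) s ->
  exists s', [/\ sorted <%R s', size s' = (size s - m)%N & all (root p^`(m)) s'].
Proof.
move=> ss ps; elim: m => [|m [[|x s'] [ss' szs' ps']]].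
- by exists s; rewrite subn0 derivn0.
- by exists [::]; split=> //; rewrite subnS -szs'.
- move: ps' => /= /andP[px ps'].
  have [s'' [xs'' szs'' ps'']] := rolle_roots ss' px ps'.
  exists s''; split; first exact: path_sorted xs''.
    by rewrite szs'' subnS -szs'.
  exact: ps''.
Qed.

Lemma chebT_roots (R : realType) (n : nat) :
  exists s : seq R, [/\ sorted <%R s, size s = n & all (root (chebT R n)) s].
Proof.
have [->|n0] := posnP n; first by exists [::].
have n0' : (0 : R) < n%:R by rewrite ltr0n.
pose t (j : nat) : R := (n%:R - j%:R - 2^-1) / n%:R * pi.
have tI j : (j < n)%N -> t j \in `[0, pi].
  move=> jn; have jn' : j%:R + 1 <= n%:R :> R by rewrite natr1 ler_nat.
  have j0 : 0 <= j%:R :> R by [].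
  rewrite in_itv/= mulr_ge0 ?pi_ge0//=; last by rewrite divr_ge0//; lra.
  by rewrite ger_pMl ?pi_gt0// ler_pdivrMr// mul1r; lra.
exists [seq cos (t j) | j <- iota 0 n]; split.
- rewrite sorted_map.
  apply: (@sub_in_sorted _ [pred j | (j < n)%N] ltn); last exact: iota_ltn_sorted.
    move=> i j ini inj ij /=; rewrite ltr_cos ?tI//.
    rewrite /t ltr_pM2r ?pi_gt0// ltr_pM2r ?invr_gt0//.
    by rewrite ltrD2r ltrD2l ltrN2 ltr_nat.
  by apply/allP => j; rewrite mem_iota.
- by rewrite size_map size_iota.
apply/allP => _ /mapP[j + ->]; rewrite mem_iota add0n => /= jn.
rewrite rootE chebT_cos.
have -> : n%:R * t j = (n - j)%:R * pi - pi / 2.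
  by rewrite /t natrB 1?ltnW//; field; rewrite lt0r_neq0.
rewrite cosBpihalf; apply/eqP; elim: (n - j)%N => [|m IH].
  by rewrite mul0r sin0.
by rewrite -natr1 mulrDl mul1r sinDpi IH oppr0.
Qed.

Lemma size_chebT_gt (R : realType) (n : nat) : (n < size (chebT R n))%N.
Proof.
have [s [ss <- ps]] := chebT_roots R n.
apply: max_poly_roots => //; last exact: lt_sorted_uniq.
apply/negP => /eqP T0; have := chebT_cos (size s) (0 : R).
by rewrite T0 horner0 mulr0 cos0 => /eqP; rewrite eq_sym oner_eq0.
Qed.

Lemma largest_root_ex (R : realType) (p : {poly R}) (x : R) :
  p != 0 -> root p x -> exists y, largest_root p y.
Proof.
move=> p0 px; have pE y : root p y = (y \in rootsR p).
  by have := roots_on_rootsR p0 y; rewrite in_itv.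
have : x \in rootsR p by rewrite -pE.
have [m mP] : exists m, forall z, z \in rootsR p ->
    m \in rootsR p /\ z <= m.
  elim: (rootsR p) => [|a s [m mP]]; first by exists 0.
  have [sm|sm] := boolP (m \in s); last first.
    exists a => z; rewrite inE => /orP[/eqP->|/mP[]].
      by rewrite mem_head.
    by rewrite (negPf sm).
  exists (Num.max a m) => z zs; split.
    by rewrite maxEle; case: ifP; rewrite ?mem_head// inE sm orbT.
  move: zs; rewrite inE le_max => /orP[/eqP->|/mP[_ ->]].
    by rewrite lexx.
  by rewrite orbT.
move=> /mP[mr _]; exists m; split; first by rewrite pE.
by move=> y; rewrite pE => /mP[].
Qed.

(* The default value 0 of xget is never used when n >= k + 2, cf. omegaP. *)
Definition omega (R : realType) (n k : nat) : R :=
  xget 0 (largest_root (chebT R n)^`(k.+1)).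

Lemma omegaP (R : realType) (n k : nat) : (k.+2 <= n)%N ->
  largest_root (chebT R n)^`(k.+1) (omega R n k).
Proof.
move=> kn; rewrite /omega; apply: (@xgetPex _ 0).
have [s [ss sz ps]] := chebT_roots R n.
have [s' [_ sz' ps']] := rolle_rootsn k.+1 ss ps.
have Tn0 : (chebT R n)^`(k.+1) != 0.
  apply/negP => /eqP T0; have := size_chebT_gt R n; rewrite ltnNge => /negP; apply.
  apply/leq_sizeP => j nj; have kj : (k.+1 <= j)%N by rewrite (leq_trans _ nj)// ltnW.
  have := coef0 R (j - k.+1); rewrite -T0 coef_derivn subnKC// => /eqP.
  by rewrite mulrn_eq0 -leqn0 leqNgt ffact_gt0 kj => /eqP.
case: s' sz' ps' => [/esym/eqP|x s' _ /= /andP[px _]].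
  by rewrite sz subn_eq0 leqNgt kn.
exact: largest_root_ex px.
Qed.

Definition tau (R : realType) (k n : nat) : R :=
  `|(chebT R n)^`(k).[omega R n k]| / (chebT R n)^`(k).[1].

Definition tau_star (R : realType) (k : nat) : R := limn (tau R k).

(* (2 k - 1)!! *)
Definition odd_dfact (k : nat) : nat := (\prod_(1 <= i < k.+1) (2 * i - 1))%N.

(* Main.v *)
(* Write [y = T_n^(k)], [omega] for its rightmost critical point, [x = cos t] and
   [x = 1 - 2s/n^2].

   Convergence: since [(n^2 - k^2) y^2 + (1 - x^2) y'^2] increases on [[0, 1]],
   [y omega] is the minimum of [y] on [[0, 1]], so [- tau_n] is the minimum of the
   rescaled polynomial [y (1 - 2s/n^2) / y 1] over any fixed large interval of [s].
   The Taylor expansion at [1] shows that these polynomials form a uniformly Cauchy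
   sequence on bounded sets, with rate [1/n^2]; hence so do their minima.

   Bound: [v = sin^k y(cos)] solves [v'' + (n^2 - k(k-1)/sin^2) v = 0], so
   [v'^2 + (n^2 - k(k-1)/sin^2) v^2] is largest at [t = pi/2], where it is at most
   [n^(2k+2)].  At the critical point this reads
   [(1-omega^2)^(k-1) ((n^2-k^2)(1-omega^2) + k) y(omega)^2 <= n^(2k+2)].
   A Sturm comparison for [sin^(k+1) y'(cos)] gives
   [n acos omega >= sqrt (k(k+1)) + 14/9], and in the limit
   [tau^2 <= (2k-1)!!^2 / (z^(2k-2) (z^2 + k))] with [z = sqrt (k(k+1)) + 14/9]. *)
Require Import Defs.
From mathcomp Require Import all_boot all_order all_algebra.
From mathcomp Require Import all_classical all_reals all_analysis.
From mathcomp Require Import polyrcf.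
From mathcomp Require Import ring lra zify.
Import Order.TTheory GRing.Theory Num.Theory.
Import numFieldNormedType.Exports.
Local Open Scope ring_scope.

Set Implicit Arguments.
Unset Strict Implicit.
Unset Printing Implicit Defensive.

(** * The Chebyshev differential equation *)

Section ChebyshevAlgebra.
Variable R : realType.
Implicit Types (n j k : nat) (x t : R).

Lemma chebTSS n : chebT R n.+2 = 2 * ('X * chebT R n.+1) - chebT R n.
Proof. by rewrite -polyC_natr mul_polyC. Qed.

(* The pair [(T_n, U_(n-1))], with the shifted index so that [U_(-1) = 0]. *)
Fixpoint chebTU n : {poly R} * {poly R} :=
  if n is m.+1 then
    let: (a, b) := chebTU m in ('X * a - (1 - 'X ^+ 2) * b, 'X * b + a)
  else (1, 0).

Lemma chebTUE n : (chebTU n).1 = chebT R n.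
Proof.
suff [] : (chebTU n).1 = chebT R n /\ (chebTU n.+1).1 = chebT R n.+1 by [].
elim: n => [|n [IH0 IH1]]; first by split=> //=; ring.
split=> //; rewrite chebTSS -IH0 -IH1 /=; case: (chebTU n) => a b /=; ring.
Qed.

(** These are the derivatives of [cos (n t)] and [sin (n t) / sin t] with respect to [cos t]; each
    induction step uses both identities. *)
Lemma chebTU_deriv n :
  (chebTU n).1^`() = n%:R * (chebTU n).2 /\
  (1 - 'X ^+ 2) * (chebTU n).2^`() = 'X * (chebTU n).2 - n%:R * (chebTU n).1.
Proof.
elim: n => [|n] /=; first by rewrite derivC deriv0; split; ring.
case: (chebTU n) => a b /= [IHa IHb]; split.
  rewrite !poly.derivE IHa.
  have -> : 1 * a + 'X * (n%:R * b) - ((0 - 'X *+ 2) * b + (1 - 'X ^+ 2) * b^`())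
   = a + 'X * (n%:R * b) + ('X *+ 2) * b - ((1 - 'X ^+ 2) * b^`()) by ring.
  by rewrite IHb -[n.+1%:R]natr1; ring.
rewrite !poly.derivE IHa.
have -> : (1 - 'X ^+ 2) * (1 * b + 'X * b^`() + n%:R * b)
   = (1 - 'X ^+ 2) * (1 + n%:R) * b + 'X * ((1 - 'X ^+ 2) * b^`()) by ring.
by rewrite IHb -[n.+1%:R]natr1; ring.
Qed.

Lemma chebTU_pell n :
  (chebTU n).1 ^+ 2 + (1 - 'X ^+ 2) * (chebTU n).2 ^+ 2 = 1.
Proof.
elim: n => [|n] /=; first by ring.
case: (chebTU n) => a b /= IH; rewrite -[RHS]IH; ring.
Qed.

Lemma chebT_ode n j :
  (1 - 'X ^+ 2) * (chebT R n)^`(j.+2) =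
  (2 * j%:R + 1)%:P * ('X * (chebT R n)^`(j.+1))
  - (n%:R ^+ 2 - j%:R ^+ 2)%:P * (chebT R n)^`(j).
Proof.
elim: j => [|j IH].
  rewrite !derivnS derivn0 -chebTUE.
  have [Ha Hb] := chebTU_deriv n.
  have -> : ((chebTU n).1^`())^`() = n%:R * (chebTU n).2^`().
    by rewrite Ha -!polyC_natr !mul_polyC derivZ.
  rewrite Ha mulrCA Hb !(polyCD, polyCN, polyCM, polyC_exp, polyC_natr); ring.
have := congr1 deriv IH.
rewrite derivB !deriv_mulC !poly.derivE -!derivnS => H.
have -> : (1 - 'X ^+ 2) * (chebT R n)^`(j.+3) =
  ((0 - 'X *+ 2) * (chebT R n)^`(j.+2) + (1 - 'X ^+ 2) * (chebT R n)^`(j.+3))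
  + ('X *+ 2) * (chebT R n)^`(j.+2) by ring.
rewrite H -[in j.+1%:R]natr1 !(polyCD, polyCN, polyCM, polyC_exp, polyC_natr); ring.
Qed.

Lemma horner_chebT_ode n j x :
  (1 - x ^+ 2) * (chebT R n)^`(j.+2).[x] =
  (2 * j%:R + 1) * x * (chebT R n)^`(j.+1).[x]
  - (n%:R ^+ 2 - j%:R ^+ 2) * (chebT R n)^`(j).[x].
Proof.
have := congr1 (horner^~ x) (chebT_ode n j).
by rewrite !hornerE.
Qed.

Lemma chebT_at1 n : (chebT R n).[1] = 1.
Proof. by rewrite -[in LHS](cos0 R) chebT_cos mulr0 cos0. Qed.

(** At [1] the factor [1 - x^2] kills the second-order term, and the differential equation becomes a
    one-step recurrence in [j]. *)
Lemma derivn_chebT_at1 n j : (chebT R n)^`(j).[1] =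
  \prod_(i < j) ((n%:R ^+ 2 - i%:R ^+ 2) / (2 * i%:R + 1)).
Proof.
elim: j => [|j IH]; first by rewrite derivn0 chebT_at1 big_ord0.
rewrite big_ord_recr /= -IH mulrA.
have := horner_chebT_ode n j 1; rewrite expr1n subrr mul0r mulr1 => /eqP.
rewrite eq_sym subr_eq0 => /eqP H.
have j0 : 2 * j%:R + 1 != 0 :> R by rewrite lt0r_neq0// ltr_wpDl// mulr_ge0.
by apply: (mulfI j0); rewrite H; field.
Qed.

Lemma sqr_natB_ge0 n j : (j <= n)%N -> 0 <= n%:R ^+ 2 - j%:R ^+ 2 :> R.
Proof. by move=> jn; rewrite subr_ge0 lerXn2r ?nnegrE// ler_nat. Qed.

Lemma derivn_chebT_at1_gt0 n j : (j <= n)%N -> 0 < (chebT R n)^`(j).[1].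
Proof.
move=> jn; rewrite derivn_chebT_at1; apply: prodr_gt0 => i _.
rewrite divr_gt0 ?subr_gt0 ?ltrXn2r ?ltr_nat// ?ltr_wpDl ?mulr_ge0//.
exact: leq_trans jn.
Qed.

Lemma derivn_chebT_at1_ge0 n j : 0 <= (chebT R n)^`(j).[1].
Proof.
have [/derivn_chebT_at1_gt0/ltW //|nj] := leqP j n.
(* For [j > n] the factor of index [n] vanishes. *)
by rewrite derivn_chebT_at1 (bigD1 (Ordinal nj))//= subrr mul0r mul0r.
Qed.

(** At [0] the equation reads [y_(j+2) = - (n^2 - j^2) y_j], so each step multiplies the left side
    by at most [n^2]. The start is [cos^2 + sin^2 = 1] in the form [chebTU_pell]. *)
Lemma derivn_chebT_at0 n j : (j <= n)%N ->
  n%:R ^+ 2 * (chebT R n)^`(j).[0] ^+ 2 + (chebT R n)^`(j.+1).[0] ^+ 2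
  <= n%:R ^+ 2 ^+ j.+1.
Proof.
elim: j => [_|j IH jn].
  have := congr1 (horner^~ 0) (chebTU_pell n).
  rewrite !hornerE /= expr0n subr0 mul1r -chebTUE => H.
  rewrite (chebTU_deriv n).1 -polyC_natr hornerCM expr1.
  by rewrite -[leRHS]mulr1 -H le_eqVlt; apply/orP; left; apply/eqP; ring.
have := horner_chebT_ode n j 0; rewrite expr0n subr0 mul1r mulr0 mul0r sub0r => ->.
rewrite [leRHS]exprS; apply: le_trans (ler_wpM2l _ (IH (ltnW jn))); last exact: exprn_ge0.
rewrite sqrrN mulrDr addrC lerD2r mulrA exprMn ler_wpM2r ?sqr_ge0//.
rewrite -expr2 lerXn2r ?nnegrE ?sqr_natB_ge0 ?exprn_ge0//; first exact: ltnW.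
by rewrite lerBlDr lerDl exprn_ge0.
Qed.

End ChebyshevAlgebra.

(** * The rightmost critical point *)

Section LargestRoot.
Variable R : realType.
Implicit Types (p : {poly R}) (n j k : nat) (x y b : R) (s : seq R).

(** Each use of Rolle's theorem costs one root and moves the leftmost one to the right. *)
Lemma rolle_root_ge p x s : path <%R x s -> root p x -> all (root p) s ->
  exists2 y, x <= y & root p^`(size s) y.
Proof.
elim: {s}(size s) {-2}s (erefl (size s)) x p => [|m IH] s sm x p xs px ps.
  by exists x; rewrite ?sm ?derivn0.
have [s' [xs' ss' ps']] := rolle_roots xs px ps.
case: s' xs' ss' ps' => [|z s'] /=; first by move=> _; rewrite sm.
move=> /andP[xz zs'] ss' /andP[pz ps'].
have ms' : size s' = m by move: ss'; rewrite sm => -[].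
have [y zy py] := IH s' ms' z p^`() zs' pz ps'.
by exists y; [exact: le_trans (ltW xz) zy | rewrite sm derivSn -ms'].
Qed.

Lemma largest_root_gt0 p x b y :
  largest_root p x -> x < b -> 0 < p.[b] -> x < y -> 0 < p.[y].
Proof.
move=> [_ xmax] xb pb xy; rewrite ltNge; apply/negP => py.
have [z xz pz] : exists2 z, x < z & root p z.
  have [yb|/ltW yb] := leP y b.
    have [|z + pz] := @polyrcf.poly_ivt R p y b yb; first by rewrite pmulr_lle0.
    by rewrite in_itv/= => /andP[yz _]; exists z; rewrite // (lt_le_trans xy).
  have [|z + pz] := @polyrcf.poly_ivt R p b y yb; first by rewrite pmulr_rle0.
  by rewrite in_itv/= => /andP[yz _]; exists z; rewrite // (lt_le_trans xb).
by have := xmax _ pz; rewrite leNgt xz.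
Qed.

(** Writing [p = q (X - x)] gives [p'(x) = q(x)]; were it negative, [q] would vanish between [x] and
    [b], beyond the largest root of [p]. *)
Lemma largest_root_deriv_ge0 p x b :
  largest_root p x -> x < b -> 0 < p.[b] -> 0 <= p^`().[x].
Proof.
move=> px xb pb; have [/factor_theorem [q pq] _] := px.
have -> : p^`().[x] = q.[x].
  by rewrite pq derivM derivXsubC !hornerE subrr mulr0 add0r.
rewrite leNgt; apply/negP => qx.
have qb : 0 < q.[b].
  by move: pb; rewrite pq hornerM hornerXsubC pmulr_lgt0 ?subr_gt0.
have [z /andP[+ _] qz] : {z | z \in `]x, b[ & root q z}.
  by apply: poly_ivtoo; [exact: ltW | rewrite nmulr_rlt0].
rewrite bnd_simp => xz; have := largest_root_gt0 px xb pb xz.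
by rewrite pq hornerM (rootP qz) mul0r ltxx.
Qed.

(** The Taylor coefficients at [1] are nonnegative, and the constant one is positive. *)
Lemma derivn_chebT_gt0 n j x :
  (j <= n)%N -> 1 <= x -> 0 < (chebT R n)^`(j).[x].
Proof.
move=> jn x1; set p := (chebT R n)^`(j).
have p1 : 0 < p.[1] by exact: derivn_chebT_at1_gt0.
have -> : x = 1 + (x - 1) by ring.
rewrite nderiv_taylor; last exact: mulrC.
have : (0 < size p)%N.
  by rewrite lt0n size_poly_eq0; apply: contraTneq p1 => ->; rewrite horner0 ltxx.
case: (size p) => // m _; rewrite big_ord_recl /= mulr1 nderivn0.
rewrite ltr_wpDr//; apply: sumr_ge0 => i _; rewrite mulr_ge0//; last first.
  by rewrite exprn_ge0// subr_ge0.
have : 0 <= p^`((bump 0 i)).[1].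
  have -> : p^`(bump 0 i) = (chebT R n)^`(bump 0 i + j) by rewrite /derivn iterD.
  exact: derivn_chebT_at1_ge0.
by rewrite nderivn_def hornerMn pmulrn_lge0// fact_gt0.
Qed.

End LargestRoot.

Section Omega.
Variables (R : realType) (n k : nat).
Hypothesis kn : (k.+2 <= n)%N.
Local Notation om := (omega R n k).
Local Notation dT j x := ((chebT R n)^`(j).[x]).

Lemma omega_root : dT k.+1 om = 0.
Proof. by have [/rootP] := omegaP R kn. Qed.

Lemma omega_lt1 : om < 1.
Proof.
rewrite ltNge; apply/negP => /(derivn_chebT_gt0 (ltnW kn)).
by rewrite omega_root ltxx.
Qed.

Lemma derivn_chebT_gt0_right x : om < x -> 0 < dT k.+1 x.
Proof.
move=> ox; apply: (largest_root_gt0 (omegaP R kn) omega_lt1) => //.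
by apply: derivn_chebT_at1_gt0; exact: ltnW.
Qed.

Lemma derivn_chebT_omega_ge0 : 0 <= dT k.+2 om.
Proof.
rewrite derivnS; apply: (largest_root_deriv_ge0 (omegaP R kn) omega_lt1).
by apply: derivn_chebT_at1_gt0; exact: ltnW.
Qed.

Lemma sqr_natB_gt0 : 0 < n%:R ^+ 2 - k%:R ^+ 2 :> R.
Proof. by rewrite subr_gt0 ltrXn2r ?nnegrE// ltr_nat; exact: ltnW. Qed.

(** Without its first-order term, the equation at [omega] gives [y] and [y''] opposite signs. *)
Lemma critical_value_le0 : 0 <= om -> dT k om <= 0.
Proof.
move=> o0; have := horner_chebT_ode n k om; rewrite omega_root mulr0 sub0r => H.
rewrite -(pmulr_rle0 _ sqr_natB_gt0) -oppr_ge0 -H mulr_ge0 ?derivn_chebT_omega_ge0// subr_ge0.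
by rewrite expr_le1// (ltW omega_lt1).
Qed.

Lemma critical_value_min (x : R) : 0 <= om -> 0 <= x <= 1 -> dT k om <= dT k x.
Proof.
move=> o0 /andP[x0 x1]; have [ox|xo] := leP om x.
  apply: (@ler_hornerW _ om 1); rewrite ?in_itv/= ?ox ?x1 ?lexx ?(ltW omega_lt1)//.
  by move=> z; rewrite in_itv/= => /andP[oz _]; rewrite -derivnS ltW ?derivn_chebT_gt0_right.
(* Left of [omega]: the equation yields [E' = 4 k x y'^2], so [y(x)^2 <= y(omega)^2], and
   [y(omega) <= 0] turns this into a lower bound for [y(x)]. *)
pose E : {poly R} := (n%:R ^+ 2 - k%:R ^+ 2)%:P * (chebT R n)^`(k) ^+ 2
  + (1 - 'X ^+ 2) * (chebT R n)^`(k.+1) ^+ 2.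
have dE z : E^`().[z] = 4 * k%:R * z * dT k.+1 z ^+ 2.
  have := horner_chebT_ode n k z.
  rewrite /E derivD deriv_mulC !poly.derivE -!derivnS !hornerE.
  move: (dT k z) (dT k.+1 z) (dT k.+2 z) => a b c /=.
  rewrite mulrBl mul1r => /(canRL (subrK _)) /(canLR (addKr _)) /esym H; ring: H.
have : E.[x] <= E.[om].
  apply: (@ler_hornerW _ 0 1 E); rewrite ?in_itv/= ?x0 ?x1 ?o0 ?(ltW omega_lt1) ?(ltW xo)//.
  move=> z; rewrite in_itv/= => /andP[z0 _].
  by rewrite dE mulr_ge0 ?sqr_ge0// mulr_ge0// ltW.
have Ez z : E.[z] = (n%:R ^+ 2 - k%:R ^+ 2) * dT k z ^+ 2
    + (1 - z ^+ 2) * dT k.+1 z ^+ 2.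
  by rewrite /E !hornerE /=; ring.
rewrite !Ez omega_root expr0n mulr0 addr0 => H.
have : dT k x ^+ 2 <= dT k om ^+ 2.
  rewrite -(ler_pM2l sqr_natB_gt0); apply: le_trans H; rewrite lerDl.
  by rewrite mulr_ge0 ?sqr_ge0// subr_ge0 expr_le1.
have := critical_value_le0 o0; move: (dT k om) (dT k x) => a b a0 ab.
by rewrite leNgt; apply/negP => ba; nra.
Qed.

End Omega.

(** * An amplitude bound at the critical point *)

Local Notation dT n j x := ((chebT _ n)^`(j).[x]).

Lemma critical_value_sqr_le (R : realType) (n m : nat) (kn : (m.+3 <= n)%N)
    (om := omega R n m.+1) : 0 <= om ->
  (1 - om ^+ 2) ^+ m
   * ((n%:R ^+ 2 - m.+1%:R ^+ 2) * (1 - om ^+ 2) + m.+1%:R)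
   * (chebT R n)^`(m.+1).[om] ^+ 2 <= n%:R ^+ 2 ^+ m.+2.
Proof.
move=> o0.
(* [(sin t)^m H(cos t)] is the derivative of [(sin t)^(m+1) T_n^(m+1)(cos t)]. *)
pose H : {poly R} := m.+1%:R%:P * ('X * (chebT R n)^`(m.+1))
  - (1 - 'X ^+ 2) * (chebT R n)^`(m.+2).
have Hz z : H.[z] = m.+1%:R * z * dT n m.+1 z - (1 - z ^+ 2) * dT n m.+2 z.
  by rewrite /H !hornerE /=; ring.
have dH z : H^`().[z] = (n%:R ^+ 2 - m.+1%:R * m%:R) * dT n m.+1 z
   - m%:R * z * dT n m.+2 z.
  have := horner_chebT_ode n m.+1 z.
  rewrite /H derivB deriv_mulC !poly.derivE -!derivnS !hornerE.
  move: (dT n m.+1 z) (dT n m.+2 z) (dT n m.+3 z) => a b c /=.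
  rewrite mulrBl mul1r => /(canRL (subrK _)) /(canLR (addKr _)) /esym E.
  rewrite -[m.+1%:R]natr1 in E *; ring: E.
clearbody H.
pose G : {poly R} := H ^+ 2
  + ((n%:R ^+ 2)%:P * (1 - 'X ^+ 2) - (m.+1%:R * m%:R)%:P) * (chebT R n)^`(m.+1) ^+ 2.
have Gz z : G.[z] = H.[z] ^+ 2
    + (n%:R ^+ 2 * (1 - z ^+ 2) - m.+1%:R * m%:R) * dT n m.+1 z ^+ 2.
  by rewrite /G !hornerE /=; ring.
have dG z : (1 - z ^+ 2) * G^`().[z] = 2 * m%:R * z * G.[z]
    - 2 * m%:R * m.+1%:R * z * dT n m.+1 z ^+ 2.
  rewrite Gz {1}/G !poly.derivE -!derivnS !hornerE dH Hz.
  move: (dT n m.+1 z) (dT n m.+2 z) => a b /=.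
  by rewrite -[m.+1%:R]natr1; ring.
clearbody G.
(* With [x = cos t] and [v = sin^(m+1) T_n^(m+1)(cos)], the polynomial [F] is
   [v'^2 + (n^2 - m(m+1)/sin^2) v^2]. *)
pose F : {poly R} := (1 - 'X ^+ 2) ^+ m * G.
have Fz z : F.[z] = (1 - z ^+ 2) ^+ m * G.[z].
  by rewrite /F !hornerE /=.
have dF z : (1 - z ^+ 2) * F^`().[z]
    = - ((1 - z ^+ 2) ^+ m * (2 * m%:R * m.+1%:R * z * dT n m.+1 z ^+ 2)).
  have dW : (1 - z ^+ 2) * ((1 - 'X ^+ 2) ^+ m)^`().[z]
      = - (2 * m%:R * z * (1 - z ^+ 2) ^+ m).
    case: (m) => [|l]; first by rewrite expr0 -polyC1 derivC hornerC; ring.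
    rewrite deriv_exp !poly.derivE !hornerE hornerMn !hornerE /= [_ ^+ l.+1]exprS.
    by rewrite -[_ *+ l.+1]mulr_natl; ring.
  rewrite /F derivM hornerD !hornerM mulrDr [X in X + _]mulrA dW [X in _ + X]mulrCA dG !hornerE /=; ring.
clearbody F.
have o1 : om < 1 := omega_lt1 R kn.
have w0 z : 0 <= z -> z <= 1 -> 0 <= 1 - z ^+ 2.
  by move=> z0 z1; rewrite subr_ge0 expr_le1.
(* [F] decreases on [[0, 1]]: by [dF], its derivative times [1 - z^2 > 0] is nonpositive there. *)
have : F.[om] <= F.[0].
  rewrite -lerN2 -!hornerN.
  apply: (@ler_hornerW _ 0 1); rewrite ?in_itv/= ?lexx ?ler01 ?o0 ?(ltW o1)//.
  move=> z; rewrite in_itv/= => /andP[z0 z1].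
  have w1 : 0 < 1 - z ^+ 2 by rewrite subr_gt0 expr_lt1// ltW.
  rewrite derivN hornerN -(pmulr_rge0 _ w1) mulrN dF opprK.
  apply: mulr_ge0; first exact/exprn_ge0/ltW.
  by apply: mulr_ge0 (sqr_ge0 _); apply: mulr_ge0 (ltW z0); rewrite !mulr_ge0.
(* At [om] the derivative drops out of [H]; at [0] only the derivative remains, and
   [derivn_chebT_at0] applies. *)
rewrite !Fz !Gz !Hz omega_root// mulr0 subr0 => FF.
have := derivn_chebT_at0 R (ltnW (ltnW kn)); apply: le_trans.
move: FF; rewrite !(mulr0, mul0r, expr0n, subr0, expr1n, sub0r, mul1r, mulr1) sqrrN.
move=> FF; apply: le_trans (le_trans FF _).
  rewrite le_eqVlt; apply/orP; left; apply/eqP.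
  by rewrite -[m.+1%:R]natr1; ring.
rewrite addrC lerD2r ler_wpM2r ?sqr_ge0// gerBl//.
Qed.

(** * Location of the critical point *)

Section Trigonometry.
Variable R : realType.
Implicit Types (f df : R -> R) (n j k : nat) (x y a b : R).

Lemma MVT_everywhere f df a b : a < b -> (forall x, is_derive x 1 f (df x)) ->
  exists c, [/\ a < c, c < b & f b - f a = df c * (b - a)].
Proof.
move=> ab fdf; have [|c + ->] := MVT ab (fun x _ => fdf x).
  apply: continuous_subspaceT => x; apply/differentiable_continuous/derivable1_diffP.
  by have [] := fdf x.
by rewrite in_itv/= => /andP[ac cb]; exists c.
Qed.

Lemma sin_sqr_le x : 0 <= x -> sin x ^+ 2 <= x ^+ 2.
Proof.
rewrite le_eqVlt => /orP[/eqP<-|x0]; first by rewrite sin0.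
have [c [_ _]] := MVT_everywhere x0 (@is_derive_sin R).
rewrite sin0 !subr0 => ->; rewrite exprMn ler_piMl ?sqr_ge0//.
Qed.

Lemma sin_sqr_lt x : 0 < x < 2 -> sin x ^+ 2 < x ^+ 2.
Proof.
move=> /andP[x0 x2]; have [c [c0 cx]] := MVT_everywhere x0 (@is_derive_sin R).
rewrite sin0 !subr0 => ->; rewrite exprMn gtr_pMl ?exprn_gt0//.
by rewrite cos2sin2 gtrBl exprn_gt0// sin2_gt0// c0 (lt_trans cx x2).
Qed.

(** Half-angle formula [cos x = 1 - 2 sin^2 (x/2)]. *)
Lemma cos_ge_quadratic x : 0 <= x -> 1 - x ^+ 2 / 2 <= cos x.
Proof.
move=> x0; have -> : x = (x / 2) *+ 2 by rewrite -mulr_natr mulfVK ?pnatr_eq0.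
have y0 : 0 <= x / 2 by rewrite divr_ge0.
rewrite cos_mulr2n cos2sin2; have := sin_sqr_le y0.
set s := sin _ ^+ 2; rewrite -(mulr_natr (x / 2)); lra.
Qed.

Lemma sin_ge_cubic x : 0 <= x -> x * (1 - x ^+ 2 / 2) <= sin x.
Proof.
rewrite le_eqVlt => /orP[/eqP<-|x0]; first by rewrite sin0 mul0r.
have [c [c0 cx]] := MVT_everywhere x0 (@is_derive_sin R).
rewrite sin0 !subr0 => ->; rewrite mulrC ler_wpM2r ?(ltW x0)//.
apply: le_trans (cos_ge_quadratic (ltW c0)).
by rewrite lerD2l lerN2 ler_wpM2r// lerXn2r ?nnegrE//; exact: ltW.
Qed.

(* [14/9] is a lower bound for [pi/2], obtained by two angle doublings from
   [cos (7/18) >= 1 - (7/18)^2/2]. *)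
Lemma cos_gt0_le x : 0 <= x -> 9 * x <= 14 -> 0 < cos x.
Proof.
move=> x0 x1; pose y := x / 4.
have xy : x = y * 4 by rewrite mulfVK ?pnatr_eq0.
have -> : x = y *+ 2 *+ 2 by rewrite xy -mulrnA; ring.
have y0 : 0 <= y by rewrite divr_ge0.
have y1 : 18 * y <= 7 by move: x1; rewrite xy; lra.
rewrite !cos_mulr2n; have := cos_ge_quadratic y0.
move: (cos y) y0 y1 => c; move: (y) => {x x0 x1 y xy} y y0 y1 yc.
have yy : y * (18 * y) <= y * 7 by rewrite ler_wpM2l.
(* [61/66] lies just below [1 - (7/18)^2/2]. Below, [29/41] lies just above [1/sqrt 2], as
   [2 * 29^2 = 41^2 + 1], so the second doubling stays positive. *)
have c1 : 61 <= 66 * c by lra.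
have c2 : c * 61 <= c * (66 * c) by rewrite ler_wpM2l//; lra.
have d1 : 29 <= 41 * (c ^+ 2 *+ 2 - 1) by lra.
move: (c ^+ 2 *+ 2 - 1) d1 => d d1.
have d2 : d * 29 <= d * (41 * d) by rewrite ler_wpM2l//; lra.
by lra.
Qed.

End Trigonometry.

(** * A lower bound for the critical point by Rolle's theorem *)

Section OmegaBounds.
Variables (R : realType) (n k : nat).
Hypothesis kn : (k.+2 <= n)%N.
Local Notation om := (omega R n k).

Let n0 : 0 < n%:R :> R.
Proof. by rewrite ltr0n; exact: leq_ltn_trans kn. Qed.

(** The angle is that of the smallest among the [k+2] largest zeros of [T_n]; applied [k+1] times to
    these, Rolle's theorem leaves a zero of [T_n^(k+1)] to its right. *)
Lemma omega_ge_cos : cos ((k%:R + 3 / 2) * pi / n%:R) <= om.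
Proof.
(* The angles decrease in [j], so that the zeros [u j] increase. *)
pose t (j : nat) : R := ((k.+1%:R - j%:R + 2^-1) * pi) / n%:R.
pose u j := cos (t j).
have tI j : (j < k.+2)%N -> t j \in `[0, pi].
  move=> jn; have jn' : j%:R <= k.+1%:R :> R by rewrite ler_nat.
  have kn' : k.+1%:R + 1 <= n%:R :> R by rewrite natr1 ler_nat.
  have j0 : 0 <= j%:R :> R by [].
  rewrite in_itv/= divr_ge0 ?(ltW n0) ?mulr_ge0 ?pi_ge0//=; last by lra.
  by rewrite ler_pdivrMr// mulrC ler_wpM2l ?pi_ge0//; lra.
have xs : path <%R (u 0%N) [seq u j | j <- iota 1 k.+1].
  rewrite -[path _ _ _]/(sorted <%R [seq u j | j <- iota 0 k.+2]) sorted_map.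
  apply: (@sub_in_sorted _ [pred j | (j < k.+2)%N] ltn); last exact: iota_ltn_sorted.
    move=> i j ini inj ij /=; rewrite ltr_cos ?tI//.
    rewrite /t ltr_pM2r ?invr_gt0// ltr_pM2r ?pi_gt0//.
    by rewrite ltrD2r ltrD2l ltrN2 ltr_nat.
  by apply/allP => j; rewrite mem_iota.
have ur j : (j < k.+2)%N -> root (chebT R n) (u j).
  move=> jk; rewrite rootE chebT_cos.
  have -> : n%:R * t j = (k.+2 - j)%:R * pi - pi / 2.
    by rewrite /t natrB 1?ltnW// -[k.+2%:R]natr1; field; rewrite lt0r_neq0.
  rewrite cosBpihalf; apply/eqP; elim: (k.+2 - j)%N => [|m IH].
    by rewrite mul0r sin0.
  by rewrite -natr1 mulrDl mul1r sinDpi IH oppr0.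
have us : all (root (chebT R n)) [seq u j | j <- iota 1 k.+1].
  by apply/allP => _ /mapP[j + ->]; rewrite mem_iota add1n => /andP[_ jk]; exact: ur.
have [y uy] := rolle_root_ge xs (ur 0%N isT) us.
rewrite size_map size_iota => ry.
have [_ omax] := omegaP R kn; apply: le_trans (omax _ ry); apply: le_trans uy.
rewrite /u /t subr0 le_eqVlt -natr1 -addrA; apply/orP; left; apply/eqP.
by congr (cos (_ * _ / _)); lra.
Qed.

(** A coarser form, with [3/2] rounded up to [2]: it confines [n^2 (1 - omega)] to a window
    independent of [n]. *)
Lemma omega_ge : 1 - ((k%:R + 2) * pi / n%:R) ^+ 2 / 2 <= om.
Proof.
have k0 : 0 <= k%:R :> R by [].
apply: le_trans omega_ge_cos.
have y0 : 0 <= (k%:R + 3 / 2) * pi / n%:R :> R.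
  by rewrite divr_ge0 ?(ltW n0)// mulr_ge0 ?pi_ge0//; lra.
apply: le_trans (cos_ge_quadratic y0).
rewrite lerD2l lerN2 ler_wpM2r// lerXn2r ?nnegrE//.
  by rewrite divr_ge0 ?(ltW n0)// mulr_ge0 ?pi_ge0//; lra.
by rewrite ler_wpM2r ?invr_ge0 ?(ltW n0)// ler_wpM2r ?pi_ge0//; lra.
Qed.

End OmegaBounds.

(** * Sturm comparison in the angular variable *)

Section Sturm.
Variable R : realType.
Implicit Types (t x : R).

(** The derivative is again a power of [sin] times a polynomial in [cos], so the formula can be
    applied twice to reach [W'']. *)
Lemma is_derive_sin_horner_cos (p : {poly R}) (i : nat) t :
  is_derive t 1 (fun t => sin t ^+ i.+1 * p.[cos t])
   (sin t ^+ i * (i.+1%:R * cos t * p.[cos t] - (1 - cos t ^+ 2) * p^`().[cos t])).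
Proof.
have d1 : is_derive t 1 (fun t : R => p.[cos t]) (p^`().[cos t] * - sin t).
  exact: (@is_derive1_comp _ (horner p) cos).
have d2 : is_derive t 1 (fun t : R => sin t ^+ i.+1) (i.+1%:R * sin t ^+ i * cos t).
  have -> : (fun t : R => sin t ^+ i.+1) = sin ^+ i.+1.
    by apply/funext => x; rewrite exprfctE.
  exact: is_derive_eq.
have d3 := is_deriveM d2 d1.
apply: is_derive_eq d3 _.
rewrite /GRing.scale /= -sin2cos2 exprS; ring.
Qed.

Lemma is_derive_affine (a m t : R) : is_derive t 1 (fun t => a * (t - m)) a.
Proof.
have d : is_derive t 1 ((@id R) - cst m) (1 - 0) by exact: is_deriveB.
have := is_deriveZ a d; rewrite subr0 => e; apply: is_derive_eq e _.
by rewrite /GRing.scale /= mulr1.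
Qed.

Lemma is_derive_cos_affine (a m t : R) :
  is_derive t 1 (fun t => cos (a * (t - m))) (- (a * sin (a * (t - m)))).
Proof.
have d := @is_derive1_comp R cos (fun t => a * (t - m)) t _ _
  (is_derive_cos _) (is_derive_affine a m t).
by apply: is_derive_eq d _; rewrite mulrC mulrN.
Qed.

Lemma is_derive_sin_affine (a m t : R) :
  is_derive t 1 (fun t => sin (a * (t - m))) (a * cos (a * (t - m))).
Proof.
have d := @is_derive1_comp R sin (fun t => a * (t - m)) t _ _
  (is_derive_sin _) (is_derive_affine a m t).
by apply: is_derive_eq d _; rewrite mulrC.
Qed.

(* With [t = acos x], [W = sin^(k+1) T_n^(k+1)(cos)] solves
   [W'' = - (n^2 - k(k+1)/sin^2) W].  It stays convex while [sin t <= c/n], where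
   [c^2 = k(k+1)], and from there on it cannot vanish before
   [cos (n (t - c/n))] does. *)
Lemma omega_le_cos (n m : nat) (c := Num.sqrt (m.+1%:R * m.+2%:R) : R)
    (om := omega R n m.+1) : (m.+3 <= n)%N -> 0 <= om ->
  om <= cos ((c + 14 / 9) / n%:R).
Proof.
move=> kn o0; set k := m.+1; pose Y := (chebT R n)^`(k.+1).
pose H : {poly R} := k.+1%:R%:P * ('X * Y) - (1 - 'X ^+ 2) * Y^`().
pose W t := sin t ^+ k.+1 * Y.[cos t].
pose W1 t := sin t ^+ k * H.[cos t].
have Hz x : H.[x] = k.+1%:R * x * Y.[x] - (1 - x ^+ 2) * Y^`().[x].
  by rewrite /H !hornerE /=; ring.
have dH x : k%:R * x * H.[x] - (1 - x ^+ 2) * H^`().[x]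
   = (k%:R * k.+1%:R - n%:R ^+ 2 * (1 - x ^+ 2)) * Y.[x].
  have := horner_chebT_ode n k.+1 x.
  rewrite Hz /H derivB deriv_mulC !poly.derivE -!derivnS !hornerE.
  move: ((chebT R n)^`(k.+1).[x]) ((chebT R n)^`(k.+2).[x]) => a b.
  move: ((chebT R n)^`(k.+3).[x]) => d /=.
  rewrite mulrBl mul1r => /(canRL (subrK _)) /(canLR (addKr _)) /esym E.
  rewrite -[k.+1%:R]natr1 in E *; ring: E.
have dW t : is_derive t 1 W (W1 t).
  apply: is_derive_eq (is_derive_sin_horner_cos Y k t) _.
  by rewrite /W1 Hz.
have dW1 t : is_derive t 1 W1
    (sin t ^+ m * ((k%:R * k.+1%:R - n%:R ^+ 2 * sin t ^+ 2) * Y.[cos t])).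
  apply: is_derive_eq (is_derive_sin_horner_cos H m t) _.
  by rewrite dH sin2cos2.
have n0 : 0 < n%:R :> R by rewrite ltr0n; exact: leq_ltn_trans kn.
have c0 : 0 < c by rewrite sqrtr_gt0 mulr_gt0.
have c2 : c ^+ 2 = k%:R * k.+1%:R by rewrite sqr_sqrtr// mulr_ge0.
have o1 : om < 1 := omega_lt1 R kn.
rewrite leNgt; apply/negP => oc.
have omI : -1 <= om <= 1 by rewrite (le_trans _ o0) ?lerN10 ?ltW.
have cosT : cos (acos om) = om by rewrite acosK.
have T0 : 0 < acos om by rewrite acos_gt0// o1 andbT (le_trans _ o0) ?lerN10.
have Tpi : acos om <= pi by exact: acos_lepi.
move: (acos om) cosT T0 Tpi => T cosT T0 Tpi.
have Tc : n%:R * T < c + 14 / 9.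
  rewrite ltNge; apply/negP; rewrite [n%:R * T]mulrC -(ler_pdivrMr _ _ n0) => cT.
  move: oc; rewrite -cosT ltr_cos ?in_itv/= ?Tpi ?(ltW T0)//.
    by rewrite ltNge cT.
  by rewrite (le_trans cT Tpi) andbT divr_ge0 ?(ltW n0)// addr_ge0 ?(ltW c0).
have T2 : T < 2.
  apply: le_lt_trans (pihalf_lt2 R); rewrite leNgt; apply/negP => pT.
  have pi0 := pi_gt0 R.
  have : cos T < cos (pi / 2).
    rewrite ltr_cos// in_itv/= ?Tpi ?(ltW T0)//; lra.
  by rewrite cosT cos_pihalf ltNge o0.
have sin0 t : 0 < t -> t <= T -> 0 < sin t.
  by move=> t0 tT; rewrite sin2_gt0// t0 (le_lt_trans tT).
have Y0 t : 0 < t -> t < T -> 0 < Y.[cos t].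
  move=> t0 tT; apply: derivn_chebT_gt0_right => //; rewrite -/om -cosT ltr_cos//.
    by rewrite in_itv/= (ltW t0) (le_trans (ltW tT)).
  by rewrite in_itv/= (ltW T0).
have W1T : W1 T <= 0.
  rewrite /W1 Hz cosT {1}/Y omega_root// mulr0 sub0r mulrN oppr_le0.
  rewrite mulr_ge0 ?exprn_ge0 ?(ltW (sin0 _ _ _))// mulr_ge0 ?derivn_chebT_omega_ge0//.
  by rewrite subr_ge0 expr_le1// ltW.
have WT : W T = 0 by rewrite /W cosT /Y omega_root// mulr0.
(* Convex phase: [n sin x < n x < c] makes [W''(x) > 0], and [W'(0) = 0]. Since [W'(T) <= 0], the
   point [T] lies beyond [c/n]. *)
have W1pos s : 0 < s -> s <= T -> n%:R * s <= c -> 0 < W1 s.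
  move=> s0 sT sc; have [x [x0 xs]] := MVT_everywhere s0 dW1.
  rewrite {2}/W1 trigo.sin0 expr0n mul0r !subr0 => ->.
  have xT : x < T by exact: lt_le_trans sT.
  rewrite mulr_gt0// mulr_gt0 ?exprn_gt0 ?sin0 ?ltW// mulr_gt0 ?Y0//.
  rewrite subr_gt0 -c2 -exprMn.
  have xc : n%:R * x < c by apply: lt_le_trans sc; rewrite ltr_pM2l.
  have x2 : 0 < x < 2 by rewrite x0 (lt_trans xT).
  apply: (@lt_le_trans _ _ ((n%:R * x) ^+ 2)).
    by rewrite !exprMn ltr_pM2l ?exprn_gt0// sin_sqr_lt.
  by rewrite lerXn2r ?nnegrE ?mulr_ge0 ?ltW.
have [Tle|Tgt] := leP (n%:R * T) c.
  by have := W1pos T T0 (lexx _) Tle; rewrite ltNge W1T.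
pose s := c / n%:R.
have s0 : 0 < s by rewrite divr_gt0.
have sT : s < T by rewrite ltr_pdivrMr// mulrC.
have ns : n%:R * s = c by rewrite mulrC divfK// gt_eqF.
(* The Wronskian of [W] and [cos (n (t - s))]; its derivative is [cos (n (t - s)) k(k+1) W / sin^2].
   Positive at [s] and nonpositive at [T], it cannot be nondecreasing. *)
pose P t := W1 t * cos (n%:R * (t - s)) + (n%:R * W t) * sin (n%:R * (t - s)).
have dP t : is_derive t 1 P
    (cos (n%:R * (t - s)) * (sin t ^+ m * (k%:R * k.+1%:R * Y.[cos t]))).
  have d1 := is_deriveM (dW1 t) (is_derive_cos_affine n%:R s t).
  have d2 := is_deriveM (is_deriveZ n%:R (dW t)) (is_derive_sin_affine n%:R s t).
  apply: is_derive_eq (is_deriveD d1 d2) _.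
  rewrite /W /GRing.scale /= /GRing.scale /= [_ ^+ k.+1]exprS [_ ^+ k]exprS; ring.
have [x [sx xT]] := MVT_everywhere sT dP.
have x0 : 0 < x by exact: lt_trans sx.
(* Here [14/9 < pi/2] enters: [n (t - s) <= n T - c < 14/9]. *)
have nsx t : s <= t -> t <= T -> 0 < cos (n%:R * (t - s)).
  move=> st tT; apply: cos_gt0_le.
    by rewrite mulr_ge0 ?(ltW n0)// subr_ge0.
  have : n%:R * t <= n%:R * T by rewrite ler_wpM2l// ltW.
  by rewrite mulrBr ns; lra.
have PT : P T <= 0.
  by rewrite /P WT mulr0 mul0r addr0 mulr_le0_ge0// ltW// nsx// ltW.
have Ps : 0 < P s.
  rewrite /P subrr mulr0 cos0 trigo.sin0 mulr0 addr0 mulr1 W1pos// ?ns//.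
  exact: ltW.
move=> Pd; have : 0 <= P T - P s.
  rewrite Pd; apply: mulr_ge0; last by rewrite subr_ge0 ltW.
  apply: mulr_ge0; first by rewrite ltW// nsx// ltW.
  rewrite mulr_ge0 ?exprn_ge0 ?mulr_ge0//; first by rewrite ltW// sin0// ltW.
  by rewrite ltW// Y0.
lra.
Qed.

End Sturm.

(** * Rescaling at the endpoint and convergence *)

Section Rescaling.
Variable R : realType.
Variable k : nat.
Implicit Types (n m j N : nat) (s M : R).

(** The free bound [N] lets polynomials of different degrees be expanded over one index range. *)
Lemma horner_taylor (p : {poly R}) N x h : (size p <= N)%N ->
  p.[x + h] = \sum_(j < N) p^`N(j).[x] * h ^+ j.
Proof.
move=> pN; rewrite nderiv_taylor; last exact: mulrC.
rewrite (big_ord_widen N (fun j => p^`N(j).[x] * h ^+ j))// big_mkcond.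
apply: eq_bigr => j _; case: ifPn => //; rewrite -leqNgt => pj.
by rewrite nderivn_poly0// horner0 mul0r.
Qed.

Definition rescaled_chebT n s : R :=
  (chebT R n)^`(k).[1 - 2 * s / n%:R ^+ 2] / (chebT R n)^`(k).[1].

(** The ratio of the [j]-th coefficient of the rescaled polynomial to its limit; the limits are the
    coefficients of [0F1(; k + 1/2; - s)], a Bessel function of order [k - 1/2] up to a power. *)
Definition shrink n j : R := \prod_(i < j) (1 - (k + i)%:R ^+ 2 / n%:R ^+ 2).

Lemma rescaled_chebTE n s N : (k <= n)%N -> (0 < n)%N ->
  (size (chebT R n)^`(k) <= N)%N ->
  rescaled_chebT n s = \sum_(j < N)
    (- 2 * s) ^+ j / j`!%:R / (\prod_(i < j) (2 * (k + i)%:R + 1)) * shrink n j.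
Proof.
move=> kn n0 sN; rewrite /rescaled_chebT (horner_taylor _ _ sN) mulr_suml.
have Tk : (chebT R n)^`(k).[1] != 0 by rewrite lt0r_neq0// derivn_chebT_at1_gt0.
have n0' : n%:R != 0 :> R by rewrite pnatr_eq0 -lt0n.
apply: eq_bigr => j _.
have fj : j`!%:R != 0 :> R by rewrite pnatr_eq0 -lt0n fact_gt0.
have p0 : \prod_(i < j) (2 * (k + i)%:R + 1) != 0 :> R.
  by apply/prodf_neq0 => i _; rewrite lt0r_neq0// ltr_wpDl// mulr_ge0.
have -> : ((chebT R n)^`(k))^`N(j).[1] = (chebT R n)^`(j + k).[1] / j`!%:R.
  have -> : (chebT R n)^`(j + k) = ((chebT R n)^`(k))^`(j) by rewrite /derivn iterD.
  by rewrite (nderivn_def j) hornerMn -[_ *+ j`!]mulr_natr mulfK.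
have -> : (chebT R n)^`(j + k).[1] = (chebT R n)^`(k).[1] *
    (n%:R ^+ 2) ^+ j * shrink n j / \prod_(i < j) (2 * (k + i)%:R + 1).
  rewrite addnC !derivn_chebT_at1 big_split_ord /= -!mulrA; congr (_ * _).
  have -> : (n%:R ^+ 2) ^+ j = \prod_(i < j) n%:R ^+ 2 :> R.
    by rewrite prodr_const card_ord.
  rewrite /shrink -prodf_div -big_split /=; apply: eq_bigr => i _.
  have ki : 2 * (k + i)%:R + 1 != 0 :> R by rewrite lt0r_neq0// ltr_wpDl// mulr_ge0.
  by move: (k + i)%:R ki => a ki; field; rewrite n0' ki.
have -> : - (2 * s / n%:R ^+ 2) = - 2 * s / n%:R ^+ 2 by ring.
rewrite expr_div_n.
have n2 : (n%:R ^+ 2) ^+ j != 0 :> R by rewrite !expf_neq0.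
move: (j`!%:R) fj (\prod_(i < j) _) p0 ((n%:R ^+ 2) ^+ j) n2 => a a0 b b0 d d0.
move: ((chebT R n)^`(k).[1]) Tk ((- 2 * s) ^+ j) (shrink n j) => e e0 f g.
by field; rewrite a0 b0 d0 e0.
Qed.

(** [prod (1 - v_i) >= 1 - sum v_i], with each [v_i <= (k+j)^2 / n^2]. *)
Lemma shrink_bounds n j : (0 < n)%N -> (k <= n)%N ->
  0 <= shrink n j <= 1 /\ 1 - (j * (k + j) ^ 2)%:R / n%:R ^+ 2 <= shrink n j.
Proof.
move=> n0 kn; have n0' : 0 < n%:R ^+ 2 :> R by rewrite exprn_gt0// ltr0n.
(* If [k + j > n], the factor [i = n - k] vanishes and the lower bound is nonpositive. *)
have [jn|jn] := leqP (k + j) n; last first.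
  have jk : (n - k < j)%N by lia.
  rewrite /shrink (bigD1 (Ordinal jk))//= subnKC// divff ?gt_eqF// subrr mul0r.
  split; first by rewrite lexx ler01.
  rewrite subr_le0 ler_pdivlMr// mul1r -natrX ler_nat.
  by apply: leq_trans (leq_pmull _ _); [rewrite leq_sqr ltnW|lia].
elim: j jn => [|j IH] jn.
  by rewrite /shrink big_ord0 mul0n mul0r subr0 lexx ler01.
have jn' : (k + j <= n)%N by lia.
have [/andP[r0 r1]] := IH jn'; rewrite /shrink big_ord_recr /= -/(shrink n j).
set q := _ / _ => rl; set v := (k + j)%:R ^+ 2 / _.
have v0 : 0 <= v by rewrite divr_ge0// ltW.
have v1 : v <= 1.
  by rewrite ler_pdivrMr// mul1r -!natrX ler_nat leq_sqr.
have qv : q + v <= (j.+1 * (k + j.+1) ^ 2)%:R / n%:R ^+ 2.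
  rewrite /q /v -mulrDl ler_pM2r ?invr_gt0// -natrX -natrD ler_nat addnS.
  rewrite mulSn addnC leq_add// ?leq_sqr// leq_mul2l leq_sqr leqnSn orbT//.
split; last by nra.
by apply/andP; split; nra.
Qed.

Lemma shrink_dist n m j : (0 < n)%N -> (k <= n)%N -> (n <= m)%N ->
  `|shrink n j - shrink m j| <= (j * (k + j) ^ 2)%:R / n%:R ^+ 2.
Proof.
move=> n0 kn nm.
have [/andP[_ n1] nl] := shrink_bounds j n0 kn.
have [/andP[_ m1] ml] := shrink_bounds j (leq_trans n0 nm) (leq_trans kn nm).
have : (j * (k + j) ^ 2)%:R / m%:R ^+ 2 <= (j * (k + j) ^ 2)%:R / n%:R ^+ 2 :> R.
  have m0 : (0 < m)%N := leq_trans n0 nm.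
  by rewrite ler_wpM2l// lef_pV2 ?posrE ?exprn_gt0 ?ltr0n// -!natrX ler_nat leq_sqr.
by rewrite ler_norml; move=> h; apply/andP; split; lra.
Qed.

(** With a geometric bound the exponential series absorbs the weight: [(2M)^j 8^j = (16M)^j]. *)
Lemma shrink_weight_le j : (j * (k + j) ^ 2 <= (k + 1) ^ 2 * 8 ^ j)%N.
Proof.
have jl : (j < 2 ^ j)%N by exact: ltn_expl.
have -> : (8 ^ j = 2 ^ j * (2 ^ j) ^ 2)%N.
  by rewrite -[8%N]/(2 ^ 3)%N -expnM -expnM -expnD; congr (_ ^ _)%N; lia.
rewrite mulnCA leq_mul ?(ltnW jl)// -expnMn leq_sqr.
apply: leq_trans (_ : (k + 1) * (j + 1) <= _)%N; first by nia.
by rewrite leq_mul2l (addn1 j) jl orbT.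
Qed.

Lemma rescaled_chebT_dist n m s M : (0 < n)%N -> (k <= n)%N -> (n <= m)%N ->
  0 <= s <= M ->
  `|rescaled_chebT n s - rescaled_chebT m s|
  <= (k.+1 ^ 2)%:R * expR (16 * M) / n%:R ^+ 2.
Proof.
move=> n0 kn nm /andP[s0 sM].
pose N := maxn (size (chebT R n)^`(k)) (size (chebT R m)^`(k)).
have M0 : 0 <= M := le_trans s0 sM.
rewrite (rescaled_chebTE s (N := N)) ?leq_maxl//.
rewrite (rescaled_chebTE s (N := N)) ?leq_maxr// ?(leq_trans kn)// ?(leq_trans n0)//.
rewrite -sumrB; apply: le_trans (ler_norm_sum _ _ _) _.
apply: (@le_trans _ _ (\sum_(j < N) (k.+1 ^ 2)%:R / n%:R ^+ 2 * exp_coeff (16 * M) j)).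
  apply: ler_sum => j _; rewrite -mulrBr normrM.
  have P1 : 1 <= \prod_(i < j) (2 * (k + i)%:R + 1) :> R.
    elim/big_ind: _ => // [x y x1 y1|i _]; first exact: mulr_ege1.
    by rewrite lerDr mulr_ge0.
  have h1 : `|(- 2 * s) ^+ j / j`!%:R / \prod_(i < j) (2 * (k + i)%:R + 1)|
      <= (2 * M) ^+ j / j`!%:R.
    rewrite !normrM normrX !normfV (ger0_norm (le_trans ler01 P1)) normr_nat.
    rewrite normrM normrN !ger0_norm//.
    rewrite ler_pdivrMr ?(lt_le_trans ltr01)//.
    apply: (@le_trans _ _ ((2 * M) ^+ j / j`!%:R)).
      by rewrite ler_wpM2r// lerXn2r ?nnegrE ?mulr_ge0// ler_wpM2l.
    by rewrite ler_peMr// divr_ge0// exprn_ge0// mulr_ge0.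
  have h2 := shrink_dist j n0 kn nm.
  apply: le_trans (ler_pM _ _ h1 h2) _; rewrite ?normr_ge0//.
  rewrite /exp_coeff /=.
  have -> : (16 * M) ^+ j = (2 * M) ^+ j * 8 ^+ j by rewrite -exprMn; congr (_ ^+ _); ring.
  have := shrink_weight_le j; rewrite -(ler_nat R) addn1 [in leRHS]natrM [(8 ^ j)%:R]natrX => h3.
  have -> : (k.+1 ^ 2)%:R / n%:R ^+ 2 * ((2 * M) ^+ j * 8 ^+ j / j`!%:R) =
     (2 * M) ^+ j / j`!%:R * ((k.+1 ^ 2)%:R * 8 ^+ j / n%:R ^+ 2) by ring.
  apply: ler_wpM2l; first by rewrite divr_ge0// exprn_ge0// mulr_ge0.
  by rewrite ler_wpM2r// invr_ge0 exprn_ge0.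
rewrite -mulr_sumr mulrAC ler_wpM2r// ler_wpM2l//.
rewrite -(big_mkord xpredT (exp_coeff (16 * M))).
apply: (nondecreasing_cvgn_le _ (is_cvg_series_exp_coeff (16 * M)) N).
apply/nondecreasing_seqP => i; rewrite /series /= big_nat_recr//= lerDl.
by rewrite exp_coeff_ge0// mulr_ge0.
Qed.

End Rescaling.

(** * Convergence of the minima *)

Section Convergence.
Variables (R : realType) (k : nat).
Implicit Types (n m : nat) (s : R).

(** By [omega_ge], [n >= b] ensures [omega >= 0], and [b^2/4] bounds the rescaled critical point for
    all such [n]. *)
Let b : R := (k%:R + 2) * pi.

Let b0 : 0 < b.
Proof. by rewrite mulr_gt0 ?pi_gt0// ltr_wpDl. Qed.

(* The rescaled variable [s] at which [x = 1 - 2s/n^2] is the critical point. *)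
Let crit n : R := n%:R ^+ 2 * (1 - omega R n k) / 2.

Lemma omega_ge0 n : (k.+2 <= n)%N -> b <= n%:R -> 0 <= omega R n k.
Proof.
move=> kn bn; have n0 : 0 < n%:R :> R := lt_le_trans b0 bn.
apply: le_trans (omega_ge R kn); rewrite -/b.
have : b / n%:R <= 1 by rewrite ler_pdivrMr// mul1r.
have : 0 <= b / n%:R by rewrite divr_ge0// ltW.
by move: (b / n%:R) => a a0 a1; nra.
Qed.

Lemma tau_rescaled n : (k.+2 <= n)%N -> b <= n%:R ->
  [/\ 0 <= crit n <= b ^+ 2 / 4, tau R k n = - rescaled_chebT k n (crit n) &
   forall s, 0 <= s <= b ^+ 2 / 4 ->
     rescaled_chebT k n (crit n) <= rescaled_chebT k n s].
Proof.
move=> kn bn; have n0 : 0 < n%:R :> R := lt_le_trans b0 bn.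
have o0 := omega_ge0 kn bn; have o1 := omega_lt1 R kn.
have n2 : 0 < n%:R ^+ 2 :> R by rewrite exprn_gt0.
have Tk : 0 < (chebT R n)^`(k).[1].
  by apply: derivn_chebT_at1_gt0; exact: ltnW (ltnW kn).
have xc : 1 - 2 * crit n / n%:R ^+ 2 = omega R n k.
  by rewrite /crit; field; rewrite gt_eqF.
split.
- rewrite /crit divr_ge0 ?mulr_ge0 ?subr_ge0 ?(ltW o1) ?(ltW n2)//=.
  have := omega_ge R kn; rewrite -/b expr_div_n => h.
  have : n%:R ^+ 2 * (1 - omega R n k) <= n%:R ^+ 2 * (b ^+ 2 / n%:R ^+ 2 / 2).
    by rewrite ler_pM2l//; lra.
  have -> : n%:R ^+ 2 * (b ^+ 2 / n%:R ^+ 2 / 2) = b ^+ 2 / 2.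
    by field; rewrite gt_eqF.
  lra.
- by rewrite /tau /rescaled_chebT xc ler0_norm ?critical_value_le0// mulNr.
move=> s /andP[s0 sb]; rewrite /rescaled_chebT xc ler_pM2r ?invr_gt0//.
apply: critical_value_min => //; apply/andP; split.
  rewrite subr_ge0 ler_pdivrMr// mul1r.
  have : b * b <= n%:R * n%:R by apply: ler_pM => //; exact: ltW.
  rewrite expr2 in sb; rewrite expr2; lra.
by rewrite gerBl divr_ge0 ?(ltW n2)// mulr_ge0.
Qed.

(** Two functions at distance at most [D] have minima at distance at most [D]: evaluate each at the
    minimiser of the other. *)
Lemma tau_dist n m : (k.+2 <= n)%N -> b <= n%:R -> (n <= m)%N ->
  `|tau R k n - tau R k m|
  <= (k.+1 ^ 2)%:R * expR (16 * (b ^+ 2 / 4)) / n%:R ^+ 2.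
Proof.
move=> kn bn nm; have n0 : 0 < n%:R :> R := lt_le_trans b0 bn.
have [cn -> minn] := tau_rescaled kn bn.
have bm : b <= m%:R by apply: le_trans bn _; rewrite ler_nat.
have [cm -> minm] := tau_rescaled (leq_trans kn nm) bm.
rewrite ltr0n in n0; have kn' : (k <= n)%N := ltnW (ltnW kn).
have := rescaled_chebT_dist n0 kn' nm cn.
have := rescaled_chebT_dist n0 kn' nm cm.
have := minn _ cm; have := minm _ cn.
rewrite !ler_norml; move: (_ * expR _ / _) => D.
move: (rescaled_chebT k n (crit n)) (rescaled_chebT k n (crit m)) => x x'.
move: (rescaled_chebT k m (crit n)) (rescaled_chebT k m (crit m)) => y y'.
by move=> h1 h2 /andP[h3 h4] /andP[h5 h6]; apply/andP; split; lra.
Qed.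

Lemma cvg_tau : cvgn (tau R k).
Proof.
apply/cauchy_cvgP/cauchy_exP => e e0; pose C : R := (k.+1 ^ 2)%:R * expR (16 * (b ^+ 2 / 4)).
have C0 : 0 <= C by rewrite mulr_ge0// expR_ge0.
pose N := maxn k.+2 (maxn (Num.bound b) (Num.bound (C / e))).
have bN : b <= N%:R.
  apply: le_trans (ltW (archi_boundP (ltW b0))) _.
  by rewrite ler_nat !leq_max leqnn !orbT.
have N0 : 0 < N%:R :> R := lt_le_trans b0 bN.
have N1 : 1 <= N%:R :> R by rewrite ler1n -(ltr0n R).
(* Enough for [C / N^2 < e], since [N <= N^2]. *)
have CN : C < e * N%:R.
  rewrite mulrC -ltr_pdivrMr//.
  apply: lt_le_trans (archi_boundP _) _; first by rewrite divr_ge0// ltW.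
  by rewrite ler_nat !leq_max leqnn !orbT.
exists (tau R k N); exists N => // m /= Nm.
rewrite -ball_normE /=; apply: le_lt_trans (tau_dist _ bN Nm) _.
  by rewrite leq_max leqnn.
rewrite -/C ltr_pdivrMr ?exprn_gt0// (lt_le_trans CN)// ler_pM2l//.
by rewrite ler_eXnr.
Qed.

End Convergence.

(** * The bound on the limit *)

Section Bound.
Local Open Scope classical_set_scope.
Variables (R : realType) (m : nat).
Local Notation k := m.+1.
Implicit Types (n : nat).

(** By [omega_le_cos], a lower bound for [n acos omega]. *)
Let c : R := Num.sqrt (m.+1%:R * m.+2%:R) + 14 / 9.

Let c0 : 0 < c.
Proof. by rewrite ltr_wpDl ?sqrtr_ge0// divr_gt0. Qed.

(* [S2] bounds [n^2 (1 - omega^2)] below as a polynomial in [u = 1/n^2]. *)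
Let S2 : {poly R} := (c ^+ 2)%:P * (1 - (c ^+ 2 / 2)%:P * 'X) ^+ 2.

(** [(2k-1)!! T_n^(k)(1) = n^(2k) rho(1/n^2)]. *)
Let rho : {poly R} := \prod_(i < k) (1 - (i%:R ^+ 2)%:P * 'X).

(** As a polynomial in [u = 1/n^2], it reduces the passage to the limit to evaluation at [0], where
    [S2 = c^2] and [rho = 1]. *)
Let G : {poly R} :=
  S2 ^+ m * ((1 - (k%:R ^+ 2)%:P * 'X) * S2 + k%:R%:P) * rho ^+ 2.

Let S2E u : S2.[u] = c ^+ 2 * (1 - c ^+ 2 / 2 * u) ^+ 2.
Proof. by rewrite /S2 !hornerE /=; ring. Qed.

Let rhoE u : rho.[u] = \prod_(i < k) (1 - i%:R ^+ 2 * u).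
Proof. by rewrite /rho horner_prod; apply: eq_bigr => i _; rewrite !hornerE. Qed.

Let GE u : G.[u] =
  S2.[u] ^+ m * ((1 - k%:R ^+ 2 * u) * S2.[u] + k%:R) * rho.[u] ^+ 2.
Proof. by rewrite /G !(hornerE, horner_exp). Qed.

Lemma odd_dfactE j : (odd_dfact j)%:R = \prod_(i < j) (2 * i%:R + 1) :> R.
Proof.
rewrite /odd_dfact big_add1 /= big_mkord natr_prod; apply: eq_bigr => i _.
by rewrite natrB ?muln_gt0// natrM -natr1; ring.
Qed.

Lemma derivn_chebT_at1_odd_dfact n j : (0 < n)%N ->
  (odd_dfact j)%:R * (chebT R n)^`(j).[1]
  = n%:R ^+ 2 ^+ j * \prod_(i < j) (1 - i%:R ^+ 2 * n%:R ^- 2).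
Proof.
move=> n0; have n0' : n%:R != 0 :> R by rewrite pnatr_eq0 -lt0n.
rewrite odd_dfactE derivn_chebT_at1.
have -> : (n%:R ^+ 2) ^+ j = \prod_(i < j) n%:R ^+ 2 :> R.
  by rewrite prodr_const card_ord.
rewrite -!big_split /=; apply: eq_bigr => i _.
have : 2 * i%:R + 1 != 0 :> R by rewrite lt0r_neq0// ltr_wpDl// mulr_ge0.
by move: (i%:R : R) => a a0; field; rewrite n0' a0.
Qed.

Lemma tau_sqr_bound n : (m.+3 <= n)%N -> 0 <= omega R n k -> c <= n%:R ->
  G.[n%:R ^- 2] * tau R k n ^+ 2 <= (odd_dfact k)%:R ^+ 2.
Proof.
move=> kn o0 cn; have o1 := omega_lt1 R kn.
have n0 : (0 < n)%N by exact: leq_ltn_trans kn.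
have n0' : 0 < n%:R :> R by rewrite ltr0n.
have P0 : 0 < (chebT R n)^`(k).[1] by apply: derivn_chebT_at1_gt0; exact: ltnW (ltnW kn).
have := critical_value_sqr_le kn o0.
have := derivn_chebT_at1_odd_dfact k n0; rewrite -rhoE.
have := omega_le_cos kn o0; rewrite -/c.
rewrite /tau expr_div_n real_normK ?num_real//.
move: ((chebT R n)^`(k).[1]) P0 ((chebT R n)^`(k).[omega R n k]) => P P0 y.
move: (omega R n k) o0 o1 => om o0 o1 oc PE yb.
set u := n%:R ^- 2; have u0 : 0 < u by rewrite invr_gt0 exprn_gt0.
have nu : n%:R ^+ 2 * u = 1 by rewrite mulfV// gt_eqF// exprn_gt0.
pose A := n%:R ^+ 2 * (1 - om ^+ 2).
(* [om <= cos (c/n)] gives [1 - om^2 >= sin^2 (c/n)], and the cubic bound on [sin] makes this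
   polynomial in [u]. *)
have SA : S2.[u] <= A.
  have cn0 : 0 <= c / n%:R by rewrite divr_ge0 ?(ltW c0)// ltW.
  have cn1 : c / n%:R <= 1 by rewrite ler_pdivrMr// mul1r.
  have s1 : (c / n%:R * (1 - (c / n%:R) ^+ 2 / 2)) ^+ 2 <= sin (c / n%:R) ^+ 2.
    rewrite lerXn2r ?nnegrE ?sin_ge_cubic//.
      rewrite mulr_ge0//; have : (c / n%:R) * (c / n%:R) <= 1 by rewrite mulr_ile1.
      by rewrite expr2; lra.
    rewrite (le_trans _ (sin_ge_cubic cn0))// mulr_ge0//.
    have : (c / n%:R) * (c / n%:R) <= 1 by rewrite mulr_ile1.
    by rewrite expr2; lra.
  have s2 : sin (c / n%:R) ^+ 2 <= 1 - om ^+ 2.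
    by rewrite sin2cos2 lerD2l lerN2 lerXn2r ?nnegrE// (le_trans o0).
  have -> : S2.[u] = n%:R ^+ 2 * (c / n%:R * (1 - (c / n%:R) ^+ 2 / 2)) ^+ 2.
    by rewrite S2E /u; field; rewrite gt_eqF.
  by rewrite /A ler_pM2l ?exprn_gt0// (le_trans s1 s2).
have S0 : 0 <= S2.[u] by rewrite S2E mulr_ge0 ?sqr_ge0.
have ku : 0 <= 1 - k%:R ^+ 2 * u.
  rewrite subr_ge0 -[leRHS]nu ler_pM2r// lerXn2r ?nnegrE// ler_nat.
  exact: ltnW (ltnW kn).
(* The amplitude bound multiplied by [n^(2m)]. *)
have AE : A ^+ m * ((1 - k%:R ^+ 2 * u) * A + k%:R) * y ^+ 2 <= (n%:R ^+ 2 ^+ k) ^+ 2.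
  have -> : (n%:R ^+ 2 ^+ k) ^+ 2 = (n%:R ^+ 2) ^+ m * n%:R ^+ 2 ^+ m.+2 :> R.
    by rewrite -exprM -exprD muln2 -addnn addSnnS.
  have -> : A ^+ m * ((1 - k%:R ^+ 2 * u) * A + k%:R) * y ^+ 2
     = (n%:R ^+ 2) ^+ m * ((1 - om ^+ 2) ^+ m
        * ((n%:R ^+ 2 - k%:R ^+ 2 * (n%:R ^+ 2 * u)) * (1 - om ^+ 2) + k%:R) * y ^+ 2).
    by rewrite /A exprMn; ring.
  by rewrite nu mulr1 ler_wpM2l// !exprn_ge0.
have GA : G.[u] * y ^+ 2 <= (n%:R ^+ 2 ^+ k) ^+ 2 * rho.[u] ^+ 2.
  rewrite GE mulrAC ler_wpM2r ?sqr_ge0//; apply: le_trans AE.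
  rewrite ler_wpM2r ?sqr_ge0//; apply: ler_pM.
  - by rewrite exprn_ge0.
  - by rewrite addr_ge0// mulr_ge0.
  - by rewrite lerXn2r ?nnegrE// (le_trans S0).
  - by rewrite lerD2r ler_wpM2l.
rewrite mulrA ler_pdivrMr ?exprn_gt0//; apply: le_trans GA _.
by rewrite -!exprMn -PE.
Qed.

Lemma critical_point_lower_bound :
  ((k + 2)%:R ^+ k) ^+ 2 <= (c ^+ 2) ^+ m * (c ^+ 2 + k%:R).
Proof.
pose r : R := Num.sqrt (m.+1%:R * m.+2%:R).
have r0 : 0 <= r by exact: sqrtr_ge0.
have r2 : r ^+ 2 = m.+1%:R * m.+2%:R by rewrite sqr_sqrtr// mulr_ge0.
(* For [k = 1], [c = sqrt 2 + 14/9] falls short of [3]; the summand [k] makes up for it, and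
   [sqrt 2 >= 7/5] suffices. *)
have [m0|m0] := posnP m.
  rewrite /c -/r; rewrite m0 in r2 *.
  have r1 : 7 <= 5 * r.
    rewrite leNgt; apply/negP => r7.
    have : (5 * r) * (5 * r) <= 7 * 7 by apply: ler_pM; lra.
    lra.
  rewrite expr0 mul1r !expr1; nra.
(* This amounts to [(m + 13/9)^2 <= (m+1)(m+2)], that is [7/9 <= m]. *)
have cm : m%:R + 3 <= c.
  have m1 : 1 <= m%:R :> R by rewrite ler1n.
  rewrite /c -/r -lerBlDr; set q := _ - _.
  have q0 : 0 <= q by rewrite /q; lra.
  rewrite leNgt; apply/negP => rq.
  have : r ^+ 2 < q ^+ 2 by rewrite ltrXn2r ?nnegrE.
  have -> : r ^+ 2 = m%:R ^+ 2 + 3 * m%:R + 2.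
    by rewrite r2 -[m.+2%:R]natr1 -[m.+1%:R]natr1; ring.
  have -> : q ^+ 2 = m%:R ^+ 2 + 26 / 9 * m%:R + 169 / 81 by rewrite /q; field.
  lra.
have k2 : (k + 2)%:R = m%:R + 3 :> R by rewrite -natrD; congr (_%:R); lia.
have m3 : 0 <= m%:R + 3 :> R by rewrite addr_ge0.
have cc : (m%:R + 3) ^+ 2 <= c ^+ 2 by rewrite lerXn2r ?nnegrE// ltW.
rewrite k2 -exprM mulnC exprM exprSr; apply: ler_pM.
- by rewrite exprn_ge0// exprn_ge0.
- exact: exprn_ge0.
- by rewrite lerXn2r ?nnegrE ?exprn_ge0// ltW.
- by rewrite (le_trans cc)// lerDl.
Qed.

Lemma cvg_inv_sqr : (fun n => n%:R ^- 2 : R) @ \oo --> (0 : R).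
Proof.
rewrite -(mulr0 0); have h : (fun n => n%:R^-1 : R) @ \oo --> (0 : R).
  by rewrite -cvg_shiftS; exact: cvg_harmonic.
have -> : (fun n => n%:R ^- 2 : R) = (fun n => n%:R^-1 * n%:R^-1).
  by apply/funext => n; rewrite expr2 invfM.
exact: cvgM.
Qed.

Lemma tau_star_bound : tau_star R k <= (odd_dfact k)%:R / (k + 2)%:R ^+ k.
Proof.
have ct := @cvg_tau R k.
have cG : (fun n => G.[n%:R ^- 2]) @ \oo --> G.[0].
  exact: (continuous_cvg _ (@continuous_horner R G 0) cvg_inv_sqr).
have cGt : (fun n => G.[n%:R ^- 2] * (tau R k n * tau R k n)) @ \oo -->
    G.[0] * (tau_star R k * tau_star R k).
  by apply: cvgM => //; apply: cvgM.
have bnd : G.[0] * (tau_star R k * tau_star R k) <= (odd_dfact k)%:R ^+ 2.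
  apply: (cvgr_to_le cGt).
  pose b : R := (k%:R + 2) * pi.
  exists (maxn m.+3 (maxn (Num.bound b) (Num.bound c))) => // n /=.
  rewrite !geq_max => /and3P[mn bn cn].
  have le_bound x : 0 <= x -> (Num.bound x <= n)%N -> x <= n%:R.
    by move=> x0 xn; apply: le_trans (ltW (archi_boundP x0)) _; rewrite ler_nat.
  rewrite -expr2; apply: tau_sqr_bound => //.
    by apply: omega_ge0 => //; apply: le_bound => //; rewrite mulr_ge0 ?pi_ge0.
  by apply: le_bound => //; exact: ltW.
(* Nonnegativity permits the final comparison of squares. *)
have t0 : 0 <= tau_star R k.
  apply: limr_ge => //; near=> n.
  rewrite /tau divr_ge0// derivn_chebT_at1_ge0//.
have G0 : G.[0] = (c ^+ 2) ^+ m * (c ^+ 2 + k%:R).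
  rewrite GE S2E rhoE !mulr0 subr0 expr1n !mulr1 mul1r big1 ?expr1n ?mulr1//.
  by move=> i _; rewrite mulr0 subr0.
rewrite ler_pdivlMr ?exprn_gt0//.
rewrite -(@ler_pXn2r _ 2) ?nnegrE ?mulr_ge0 ?exprn_ge0//.
rewrite exprMn mulrC; apply: le_trans bnd; rewrite -expr2 ler_wpM2r ?sqr_ge0//.
by rewrite G0 critical_point_lower_bound.
Unshelve. all: by end_near. Qed.

End Bound.

Theorem corollary1p4 (R : realType) (k : nat) (hk : (1 <= k)%N) :
  cvgn (tau R k) /\
  tau_star R k <= (odd_dfact k)%:R / (k + 2)%:R ^+ k.
Proof.
split; first exact: cvg_tau.
by case: k hk => // m _; exact: tau_star_bound.
Qed.
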